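(* Assume that $P\in\mathbb R$, $S>0$ and $g=0$. As $\alpha\to-\infty$, the number of unimodal solutions $U_{m,\alpha}(x,y)=\psi(y)\sin(mx)$ ($m\ge1$ integer, $\psi\not\equiv0$) of the stationary problem (ST) tends to infinity.
   Context: Let $\ell>0$, $\Omega=(0,\pi)\times(-\ell,\ell)$ with coordinates $(x,y)$, and $\sigma\in(0,1)$; $\|\cdot\|_0$ is the $L^2(\Omega)$ norm. Stationary problem (ST) with $g=0$: $\Delta^2u-S\|u_x\|_0^2u_{xx}+Pu_{xx}-\alpha u_y=0$ in $\Omega$; $u=u_{xx}=0$ on $\{0,\pi\}\times[-\ell,\ell]$; $u_{yy}+\sigma u_{xx}=u_{yyy}+(2-\sigma)u_{xxy}=0$ on $[0,\pi]\times\{-\ell,\ell\}$. *)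

(* Defs.v *)
From mathcomp Require Export all_boot all_order all_algebra.
From mathcomp Require Export all_classical all_reals all_analysis.

Set Implicit Arguments.
Unset Strict Implicit.
Unset Printing Implicit Defensive.

Import Order.TTheory GRing.Theory Num.Theory.
Import numFieldNormedType.Exports.

Local Open Scope classical_set_scope.
Local Open Scope ring_scope.

Section Plate.
Context {R : realType}.

Definition dx (u : R * R -> R) : R * R -> R := 'D_((1, 0) : R * R) u.
Definition dy (u : R * R -> R) : R * R -> R := 'D_((0, 1) : R * R) u.

Definition laplacian (u : R * R -> R) : R * R -> R :=
  fun z => dx (dx u) z + dy (dy u) z.

(* The partial derivatives of order at most k exist and those of order k are
   continuous, i.e. u is of class C^k on the plane. *)
Fixpoint classC (k : nat) (u : R * R -> R) : Prop :=
  if k is k'.+1 then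
    [/\ forall z, derivable u z (1, 0),
        forall z, derivable u z (0, 1),
        classC k' (dx u) & classC k' (dy u)]
  else continuous u.

Variable l : R.

Definition Omega : set (R * R) := `]0, pi[ `*` `]- l, l[.
Definition clOmega : set (R * R) := `[0, pi] `*` `[- l, l].

Definition L2norm (f : R * R -> R) : R :=
  fine ('N[(@lebesgue_measure R \x @lebesgue_measure R)%E]_2%:E
          [EFin \o f \_ Omega])%E.

Variables (sigma P S alpha : R) (g : R * R -> R).

(* A C^4 function on the closed rectangle is represented by a C^4 extension to
   the plane; the equation and the boundary conditions do not depend on the
   choice of the extension. *)
Record stationary_solution (u : R * R -> R) : Prop := StationarySolution {
  solution_C4 : classC 4 u ;
  solution_eq : forall z, Omega z ->
    laplacian (laplacian u) z - S * L2norm (dx u) ^+ 2 * dx (dx u) z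
      + P * dx (dx u) z - alpha * dy u z = g z ;
  solution_hinged : forall x y : R, x = 0 \/ x = pi -> - l <= y <= l ->
    u (x, y) = 0 /\ dx (dx u) (x, y) = 0 ;
  solution_free : forall x y : R, 0 <= x <= pi -> y = - l \/ y = l ->
    dy (dy u) (x, y) + sigma * dx (dx u) (x, y) = 0 /\
    dy (dy (dy u)) (x, y) + (2 - sigma) * dy (dx (dx u)) (x, y) = 0 }.

Definition unimodal (u : R * R -> R) : Prop :=
  exists (m : nat) (psi : R -> R),
    [/\ (1 <= m)%N,
        exists2 y : R, - l <= y <= l & psi y != 0 &
        forall z, clOmega z -> u z = psi z.2 * sin (m%:R * z.1)].

(* Restricting to clOmega (with value 0 outside) identifies two
   representatives of the same function on the closed rectangle. *)
Definition unimodal_solutions : set (R * R -> R) :=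
  [set u \_ clOmega | u in [set u | stationary_solution u /\ unimodal u]].

Definition number_unimodal_solutions : \bar R := counting unimodal_solutions.

End Plate.

(* Main.v *)
Require Import Defs.
From mathcomp Require Import all_boot all_order all_algebra.
From mathcomp Require Import all_classical all_reals all_analysis.
From mathcomp Require Import ring lra measurable_realfun.
Import Order.TTheory GRing.Theory Num.Theory.
Import numFieldNormedType.Exports.
Local Open Scope classical_set_scope.
Local Open Scope ring_scope.

(* For u = psi(y) sin(m x), (ST) becomes psi'''' - 2 m^2 psi'' + a psi' + k psi = 0
   with a = - alpha and k = m^4 + m^2 (S ||u_x||^2 - P), under free boundary
   conditions.  Any eigenvalue k > m^4 - m^2 P gives a solution after scaling psi,
   so it suffices that for each m such a k exists once a is large: distinct m give
   distinct solutions.  Write the characteristic roots as - p - d, - p + d, p +- i q,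
   so that q^2 = d^2 + 2 p^2 - 2 m^2, a = 4 p (d^2 + p^2 - m^2) and
   k = (p^2 - d^2)(p^2 + q^2).  Eliminating the oscillating modes by the conditions
   at y = l leaves a 2 x 2 determinant at y = - l, which up to exponentially small
   terms has, for p large, the sign of rho^2 - sigma m^2, where rho = p - d.  For
   fixed large a, moving p from the point where rho = sqrt(sigma) m / 2 to the point
   where rho = 2 sqrt(sigma) m changes this sign, and k >= rho p (p^2 + q^2) is
   large on the way. *)

(** * Partial derivatives through one-variable sections *)

Section SeparatedVariables.
Context {R : realType}.
Implicit Types (f : R * R -> R) (g h : R -> R) (z : R * R).

(** The difference quotient of [f] along [(1, 0)] is literally that of its horizontal section, so
    derivability and value transfer together. *)
Lemma is_derive_dx f z (df : R) :
  is_derive z.1 1 (fun x => f (x, z.2)) df -> is_derive z (1, 0) f df.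
Proof.
have E : (fun e : R => e^-1 *: ((f \o shift z) (e *: (1, 0)) - f z)) =
  (fun e : R => e^-1 *: (((fun x => f (x, z.2)) \o shift z.1) (e *: 1) - f (z.1, z.2))).
  apply/funext => e /=; rewrite -surjective_pairing.
  suff -> : e *: (1, 0) + z = (e *: 1 + z.1, z.2) by [].
  case: z => a b; congr (_, _); last (rewrite -[RHS]add0r; congr (_ + _); exact: mulr0).
move=> [dv dE]; split; first by rewrite /derivable E.
by rewrite -dE /derive E.
Qed.

Lemma is_derive_dy f z (df : R) :
  is_derive z.2 1 (fun y => f (z.1, y)) df -> is_derive z (0, 1) f df.
Proof.
have E : (fun e : R => e^-1 *: ((f \o shift z) (e *: (0, 1)) - f z)) =
  (fun e : R => e^-1 *: (((fun y => f (z.1, y)) \o shift z.2) (e *: 1) - f (z.1, z.2))).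
  apply/funext => e /=; rewrite -surjective_pairing.
  suff -> : e *: (0, 1) + z = (z.1, e *: 1 + z.2) by [].
  case: z => a b; congr (_, _); last (rewrite -[RHS]add0r; congr (_ + _); exact: mulr0).
move=> [dv dE]; split; first by rewrite /derivable E.
by rewrite -dE /derive E.
Qed.
End SeparatedVariables.

(** * Product modes and their calculus *)

Section Modes.
Context {R : realType}.
Variables (l r1 r2 p q mu : R).
Implicit Types (c : R * R * R * R) (s : R * R) (z : R * R).

(* Coefficient tuples c of real exponentials decaying from y = - l and of an
   oscillating part decaying from y = l; differentiation acts linearly on c. *)
Definition prof c (y : R) : R :=
  c.1.1.1 * expR (r1 * (y + l)) + c.1.1.2 * expR (r2 * (y + l)) +
  expR (p * (y - l)) * (c.1.2 * cos (q * (y - l)) + c.2 * sin (q * (y - l))).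

Definition profD c : R * R * R * R :=
  (r1 * c.1.1.1, r2 * c.1.1.2, p * c.1.2 + q * c.2, p * c.2 - q * c.1.2).

Definition trig s (x : R) : R := s.1 * sin (mu * x) + s.2 * cos (mu * x).

Definition trigD s : R * R := (- (mu * s.2), mu * s.1).

Definition mode c s z : R := prof c z.2 * trig s z.1.

Lemma is_derive_prof c (y : R) : is_derive y 1 (prof c) (prof (profD c) y).
Proof.
rewrite /prof; apply: is_derive_eq.

by rewrite /profD /GRing.scale /=; ring.
Qed.

Lemma is_derive_trig s (x : R) : is_derive x 1 (trig s) (trig (trigD s) x).
Proof.
rewrite /trig; apply: is_derive_eq.
by rewrite /trigD /GRing.scale /=; ring.
Qed.

Lemma is_derive_mode_x c s z : is_derive z (1, 0) (mode c s) (mode c (trigD s) z).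
Proof.
apply: is_derive_dx; have Dt := is_derive_trig s z.1.
rewrite /mode /=; exact: is_derive_eq.
Qed.

Lemma is_derive_mode_y c s z : is_derive z (0, 1) (mode c s) (mode (profD c) s z).
Proof.
apply: is_derive_dy; have Dt := is_derive_prof c z.2.
by rewrite /mode /=; apply: is_derive_eq; rewrite /GRing.scale /=; ring.
Qed.

Lemma dx_mode c s : dx (mode c s) = mode c (trigD s).
Proof. by apply/funext => z; have [] := is_derive_mode_x c s z. Qed.

Lemma dy_mode c s : dy (mode c s) = mode (profD c) s.
Proof. by apply/funext => z; have [] := is_derive_mode_y c s z. Qed.

(** Second [x]-derivatives multiply a mode by [- mu ^+ 2], so the Laplacian acts on the profile
    coefficients alone. *)
Definition lapc c : R * R * R * R :=
  let c2 := profD (profD c) in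
  (c2.1.1.1 - mu ^+ 2 * c.1.1.1, c2.1.1.2 - mu ^+ 2 * c.1.1.2,
   c2.1.2 - mu ^+ 2 * c.1.2, c2.2 - mu ^+ 2 * c.2).

Lemma laplacian_mode c s : laplacian (mode c s) = mode (lapc c) s.
Proof.
rewrite /laplacian !dx_mode !dy_mode; apply/funext => z.
by rewrite /mode /prof /trig /=; ring.
Qed.

Lemma continuous_prof c : continuous (prof c).
Proof.
move=> y; apply/differentiable_continuous/derivable1_diffP.
by have [] := is_derive_prof c y.
Qed.

Lemma continuous_trig s : continuous (trig s).
Proof.
move=> y; apply/differentiable_continuous/derivable1_diffP.
by have [] := is_derive_trig s y.
Qed.

Lemma continuous_mode c s : continuous (mode c s).
Proof.
move=> z; apply: cvgM.
- by apply: continuous_comp; [exact: cvg_snd|exact: continuous_prof].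
- by apply: continuous_comp; [exact: cvg_fst|exact: continuous_trig].
Qed.

Lemma classC_mode k c s : classC k (mode c s).
Proof.
elim: k c s => [|k IH] c s; first exact: continuous_mode.
split.
- by move=> z; have [] := is_derive_mode_x c s z.
- by move=> z; have [] := is_derive_mode_y c s z.
- by rewrite dx_mode.
- by rewrite dy_mode.
Qed.

End Modes.

(** * The L2 norm of a product function on the rectangle *)

Section SquareNorm.
Context {R : realType}.
Variable l : R.
Variables (g h : R -> R).
Hypotheses (cg : continuous g) (ch : continuous h).
Let f (z : R * R) : R := g z.2 * h z.1.
Local Notation mu := (@lebesgue_measure R \x @lebesgue_measure R)%E.

Lemma measurable_Omega : measurable (Omega l : set (measurableTypeR R * measurableTypeR R)).
Proof. by apply: measurableX; exact: measurable_itv. Qed.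

Lemma measurable_patch_Omega : measurable_fun setT (f \_ (Omega l)).
Proof.
apply/(measurable_restrictT _ measurable_Omega).
apply: (@measurable_funS _ _ _ _ setT) => //; apply: measurable_funM.
- apply: measurableT_comp; last exact: measurable_snd.
  exact: continuous_measurable_fun.
- apply: measurableT_comp; last exact: measurable_fst.
  exact: continuous_measurable_fun.
Qed.

Lemma bounded_patch_Omega : exists2 M : R, 0 <= M & forall z, `|(f \_ (Omega l)) z| <= M.
Proof.
have cf : continuous f.
  move=> z; apply: cvgM.
  - by apply: continuous_comp; [exact: cvg_snd|exact: cg].
  - by apply: continuous_comp; [exact: cvg_fst|exact: ch].
have cK : compact (clOmega l : set (R * R)).
  by apply: compact_setX; exact: segment_compact.
have /compact_bounded[M [_ HM]] := continuous_compact (continuous_subspaceT cf) cK.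
exists (`|M| + 1) => [|z]; first by rewrite addr_ge0.
rewrite patchE; case: ifPn => [|_]; last by rewrite normr0 addr_ge0.
rewrite inE => -[] /= z1 z2; apply: HM; first by rewrite ltr_pwDr// ler_norm.
exists z => //; split => /=.
- exact: subset_itv_oo_cc z1.
- exact: subset_itv_oo_cc z2.
Qed.

Lemma measurable_abse_patch_sq :
  measurable_fun setT (fun z => `|(EFin \o f \_ (Omega l)) z| `^ 2)%E.
Proof.
have mf : measurable_fun setT (EFin \o f \_ (Omega l)).
  by apply/measurable_EFinP; exact: measurable_patch_Omega.
apply: (measurableT_comp (f := fun x : \bar R => (x `^ 2)%E)).
  exact: measurable_poweR.
exact: (measurableT_comp (f := abse)).
Qed.

(** The square is dominated by [M ^+ 2] times the indicator of [Omega], a set of finite measure. *)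
Lemma Lnorm_patch_lty : ('N[mu]_2%:E [EFin \o f \_ (Omega l)] < +oo)%E.
Proof.
have [M M0 HM] := bounded_patch_Omega.
rewrite unlock; apply: poweR_lty.
apply: (@le_lt_trans _ _ (\int[mu]_z ((M ^+ 2)%:E * (\1_(Omega l) z)%:E))%E).
  apply: ge0_le_integral => //.
  - by move=> z _; exact: poweR_ge0.
  - exact: measurable_abse_patch_sq.
  - apply: emeasurable_funM => //; apply/measurable_EFinP.
    by apply: measurable_indic; exact: measurable_Omega.
  - move=> z _ /=; rewrite -EFinM lee_fin powR_mulrn// indicE.
    have := HM z; rewrite patchE; case: ifPn => _ HMz.
      by rewrite mulr1 lerXn2r// nnegrE.
    by rewrite normr0 expr0n mulr0.
rewrite ge0_integralZl//; first last.
- by rewrite lee_fin exprn_ge0.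
- apply/measurable_EFinP; apply: measurable_indic; exact: measurable_Omega.
rewrite integral_indic//; last exact: measurable_Omega.
rewrite setIT [X in (_ * X < _)%E](_ : _ =
  lebesgue_measure (`]0%R, pi[ : set R) * lebesgue_measure (`](- l)%R, l[ : set R))%E; last first.
  by apply: product_measure1E; exact: measurable_itv.
rewrite !lebesgue_measure_itv /=.
by do 2 case: ifPn => _; rewrite ?mule0 ?mul0e ?mule0 -?EFinB -?EFinM ?ltry.
Qed.

(** By continuity both factors are nonzero on a product of two balls around [z0] inside [Omega]. A
    zero norm would put this set of positive measure inside a null set. *)
Lemma Lnorm_patch_gt0 z0 : Omega l z0 -> f z0 != 0 ->
  (0 < 'N[mu]_2%:E [EFin \o f \_ (Omega l)])%E.
Proof.
move=> [/= z01 z02] fz0; rewrite lt0e Lnorm_ge0 andbT; apply/eqP => N0.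
have mf : measurable_fun (setT : set (measurableTypeR R * measurableTypeR R))
    (EFin \o f \_ (Omega l)).
  by apply/measurable_EFinP; exact: measurable_patch_Omega.
have [//|A [mA A0 HA]] := Lnorm_eq0_eq0 mf _ N0.
have [g0 h0] : g z0.2 != 0 /\ h z0.1 != 0.
  by move: fz0; rewrite mulf_eq0 negb_or => /andP[].
have nbh (k : R -> R) (x : R) (D : set R) : continuous k -> k x != 0 -> open D -> D x ->
    exists2 e : R, 0 < e & forall y, ball x e y -> k y != 0 /\ D y.
  move=> ck kx oD Dx.
  have H1 : \forall y \near x, k y != 0.
    have := ck x; move=> /cvgrPdist_lt/(_ `|k x|); rewrite normr_gt0 => /(_ kx).
    apply: filterS => y; apply: contraTneq => ->.
    by rewrite subr0 ltxx.
  have H2 : \forall y \near x, D y by apply: open_nbhs_nbhs.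
  have [e e0 He] := (nbhs_ballP x _).1 (filterI H1 H2).
  by exists e.
have [e1 e10 He1] := nbh h z0.1 _ ch h0 (itv_open _ _) z01.
have [e2 e20 He2] := nbh g z0.2 _ cg g0 (itv_open _ _) z02.
have : (mu (ball z0.1 e1 `*` ball z0.2 e2) <= mu A)%E.
  apply: le_measure; rewrite ?inE//.
    by apply: measurableX; exact: measurable_ball.
  move=> z [/= /He1[hz z1] /He2[gz z2]]; apply: HA => /= /(_ I).
  rewrite patchE mem_set; last by split.
  by move=> [] /eqP; rewrite mulf_eq0 (negbTE hz) (negbTE gz).
rewrite A0 [X in (X <= _)%E](_ : _ = (e1 *+ 2)%:E * (e2 *+ 2)%:E)%E; last first.
  rewrite -(lebesgue_measure_ball z0.1 (ltW e10)) -(lebesgue_measure_ball z0.2 (ltW e20)).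
  by apply: product_measure1E; exact: measurable_ball.
rewrite leNgt => /negP; apply.
by rewrite -EFinM lte_fin mulr_gt0// mulrn_wgt0.
Qed.

(** Homogeneity allows the norm of a mode to be prescribed by scaling; finiteness of the norm lets
    [fine] pass through the product. *)
Lemma L2normZ (k : R) : L2norm l (fun z => k * f z) = `|k| * L2norm l f.
Proof.
rewrite /L2norm.
suff -> : ('N[mu]_2%:E [EFin \o (fun z => (k * f z)%R) \_ (Omega l)] =
    `|k|%:E * 'N[mu]_2%:E [EFin \o f \_ (Omega l)])%E.
  by rewrite fineM// ge0_fin_numE ?Lnorm_ge0// Lnorm_patch_lty.
rewrite unlock.
transitivity ((\int[mu]_z ((`|k| ^+ 2)%:E * `|(EFin \o f \_ (Omega l)) z| `^ 2)) `^ 2^-1)%E.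
  congr poweR; apply: eq_integral => z _ /=.
  rewrite !patchE; case: ifPn => _.
    by rewrite -EFinM !powR_mulrn// normrM exprMn.
  by rewrite normr0 -EFinM powR0// mulr0.
rewrite ge0_integralZl//; first last.
- by move=> z _; exact: poweR_ge0.
- exact: measurable_abse_patch_sq.
rewrite poweRM ?lee_fin ?exprn_ge0//; last by apply: integral_ge0 => z _; exact: poweR_ge0.
congr (_ * _)%E.
by rewrite poweR_EFin -powR_mulrn// -powRrM mulfV// powRr1.
Qed.
End SquareNorm.

(** * From a profile to a solution of the nonlocal problem *)

Section Assembly.
Context {R : realType}.
Variables (l sigma P S : R).
Hypothesis S0 : 0 < S.

Lemma sin_natpi (m : nat) : sin (m%:R * pi) = 0 :> R.
Proof.
elim: m => [|m IH]; first by rewrite mul0r sin0.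
by rewrite -natr1 mulrDl mul1r sinDpi IH oppr0.
Qed.

(* With a = - alpha, M = m^2 and k = m^4 + m^2 (S ||u_x||^2 - P), these are the
   conditions on psi for psi(y) sin(m x) to solve (ST). *)
Record profile_solution (r1 r2 p q M a k : R) (c : R * R * R * R) : Prop := {
  profile_eq : forall y,
    prof l r1 r2 p q (profD r1 r2 p q (profD r1 r2 p q (profD r1 r2 p q (profD r1 r2 p q c)))) y
    - 2 * M * prof l r1 r2 p q (profD r1 r2 p q (profD r1 r2 p q c)) y
    + a * prof l r1 r2 p q (profD r1 r2 p q c) y + k * prof l r1 r2 p q c y = 0;
  profile_moment : forall y, y = - l \/ y = l ->
    prof l r1 r2 p q (profD r1 r2 p q (profD r1 r2 p q c)) y
    = sigma * M * prof l r1 r2 p q c y;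
  profile_shear : forall y, y = - l \/ y = l ->
    prof l r1 r2 p q (profD r1 r2 p q (profD r1 r2 p q (profD r1 r2 p q c))) y
    = (2 - sigma) * M * prof l r1 r2 p q (profD r1 r2 p q c) y;
  profile_neq0 : exists2 y : R, - l < y < l & prof l r1 r2 p q c y != 0 }.

(* The nonlocal coefficient is matched by scaling the profile, which is possible
   exactly when k exceeds m^4 - m^2 P. *)
Lemma unimodal_of_profile (m : nat) (mu r1 r2 p q alpha k : R) c :
  (0 < m)%N -> mu = m%:R -> mu ^+ 4 - mu ^+ 2 * P < k ->
  profile_solution r1 r2 p q (mu ^+ 2) (- alpha) k c ->
  exists (u : R * R -> R) (psi : R -> R),
  [/\ stationary_solution l sigma P S alpha (cst 0) u,
    exists2 y : R, - l <= y <= l & psi y != 0 &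
    forall z, u z = psi z.2 * sin (mu * z.1)].
Proof.
move=> m0 muE kK [Heq Hmom Hshear [y0 y0l cy0]].
have mR0 : 0 < mu :> R by rewrite muE ltr0n.
(* The pair [(1, 0)] encodes [sin (mu * x)], so [u0] is the [x]-derivative of the unscaled mode. *)
pose u0 := mode l r1 r2 p q mu c (trigD mu (1, 0)).
(* Chosen so that [mu * x0 = pi / 4], where the cosine is positive. *)
pose x0 : R := pi / 2 / (2 * mu).
have N0 : 0 < L2norm l u0.
  have cp := continuous_prof l r1 r2 p q c.
  have ct := continuous_trig (mu : R) (trigD mu (1, 0)).
  rewrite /L2norm fine_gt0//; apply/andP; split; last exact: Lnorm_patch_lty cp ct.
  apply: (Lnorm_patch_gt0 _ _ _ cp ct (x0, y0)).
    split => /=; rewrite in_itv//=; apply/andP; split.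
      by rewrite divr_gt0 ?mulr_gt0 ?pi_gt0.
    rewrite /x0 ltr_pdivrMr ?mulr_gt0// ltr_pM2l ?pi_gt0//.
    have : 1 <= mu :> R by rewrite muE ler1n.
    lra.
  rewrite mulf_neq0//= /trig /= mulr0 oppr0 mul0r add0r mulr1 mulf_neq0 ?gt_eqF//.
  have -> : mu * x0 = pi / 2 / 2 by rewrite /x0; field; rewrite gt_eqF.
  apply: cos_gt0_pihalf; have := @pi_gt0 R; lra.
(* The value of the squared norm of [u_x] that makes [k = mu ^+ 4 + mu ^+ 2 * (S * w - P)]. *)
pose w := (k - mu ^+ 4 + mu ^+ 2 * P) / (mu ^+ 2 * S).
have w0 : 0 < w by rewrite divr_gt0 ?mulr_gt0 ?exprn_gt0//; lra.
pose C := Num.sqrt w / L2norm l u0.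
have C0 : 0 < C by rewrite divr_gt0 ?sqrtr_gt0.
pose u := mode l r1 r2 p q mu c (C, 0).
have uE c' z : mode l r1 r2 p q mu c' (C, 0) z =
    C * prof l r1 r2 p q c' z.2 * sin (mu * z.1).
  by rewrite /mode /trig /=; ring.
have dxx c' : dx (dx (mode l r1 r2 p q mu c' (C, 0))) =
    fun z => - (mu ^+ 2 * C) * prof l r1 r2 p q c' z.2 * sin (mu * z.1).
  by rewrite !dx_mode; apply/funext => z; rewrite /mode /trig /=; ring.
have Nu : L2norm l (dx u) ^+ 2 = w.
  rewrite dx_mode (_ : mode _ _ _ _ _ _ _ _ = fun z => C * u0 z); last first.
    by apply/funext => z; rewrite /u0 /mode /trig /=; ring.
  rewrite L2normZ; [|exact: continuous_prof|exact: continuous_trig].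
  by rewrite exprMn real_normK ?num_real// exprMn exprVn mulfVK
    ?sqr_sqrtr ?ltW// expf_neq0// gt_eqF.
exists u, (fun y => C * prof l r1 r2 p q c y); split; last first.
- by move=> z; rewrite /u uE.
- exists y0; first by case/andP: y0l => *; rewrite !ltW.
  by rewrite mulf_neq0// gt_eqF.
split.
- exact: classC_mode.
- move=> z _; rewrite Nu /u !laplacian_mode dxx dy_mode !uE.
  have := Heq z.2; rewrite /= => E0.
  (* Modulo the profile equation [E0], the residual is a multiple of a factor that vanishes by the
     choice of [w]. *)
  rewrite [LHS](_ : _ = C * sin (mu * z.1) *
    ((k - mu ^+ 4 + mu ^+ 2 * P - w * (mu ^+ 2 * S)) * - prof l r1 r2 p q c z.2)).
    by rewrite /w mulfVK ?subrr ?mul0r ?mulr0// mulf_neq0 ?expf_neq0 ?gt_eqF.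
  apply/eqP; rewrite -subr_eq0; apply/eqP.
  rewrite -[RHS](mulr0 (C * sin (mu * z.1))) -E0 /lapc /prof /profD /=; ring.
- move=> x y xE _; rewrite dxx /u uE /=.
  suff -> : sin (mu * x) = 0 by rewrite !mulr0.
  by case: xE => ->; rewrite ?mulr0 ?sin0// muE sin_natpi.
- move=> x y _ yE; rewrite /u !dy_mode; split.
    rewrite dxx uE /mode Hmom// /trig /=; ring.
  rewrite !dx_mode !dy_mode /mode /= Hshear// /trig /=; ring.
Qed.
End Assembly.

(** * Counting solutions and telling modes apart *)

Section Counting.
Context {R : realType}.

Lemma counting_ge_inj {T : choiceType} (A : set T) (N : nat) (F : nat -> T) :
  (forall i, (i < N)%N -> A (F i)) ->
  (forall i j, (i < N)%N -> (j < N)%N -> F i = F j -> i = j) ->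
  (N%:R%:E <= counting A :> \bar R)%E.
Proof.
move=> FA Finj; rewrite /counting; case: ifPn => [/asboolP finA|_]; last exact: leey.
rewrite lee_fin ler_nat.
have [n An] := finA; rewrite (card_fset_set An) -card_le_II -(card_le_eqr An).
apply: (card_le_trans (B := F @` `I_N)); last first.
  by apply: subset_card_le => _ [i /= iN <-]; exact: FA.
have : ([set F i | i in `I_N] #= `I_N)%card.
  by apply: inj_card_eq => i j; rewrite !inE /=; exact: Finj.
by rewrite card_eq_le => /andP[].
Qed.

Variable l : R.
(** If [m < n], then at [x = pi / n] the right side vanishes, while [m * x] lies strictly between 0
    and [pi]. *)
Lemma sine_wave_inj (m n : nat) (psi phi : R -> R) (y : R) :
  (0 < m)%N -> (0 < n)%N -> - l <= y <= l -> psi y != 0 ->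
  (forall z, clOmega l z -> psi z.2 * sin (m%:R * z.1) = phi z.2 * sin (n%:R * z.1)) ->
  (n <= m)%N.
Proof.
move=> m0 n0 yl psiy E; rewrite leqNgt; apply/negP => mn.
have p0 := @pi_gt0 R.
have [mR nR] : 0 < m%:R :> R /\ 0 < n%:R :> R by rewrite !ltr0n.
have /= := E (pi / n%:R, y) _.
rewrite [n%:R * _]mulrC divfK ?gt_eqF// sinpi mulr0 => H.
have /eqP : psi y * sin (m%:R * (pi / n%:R)) = 0.
  apply: H; split => /=; rewrite in_itv //=.
  rewrite divr_ge0 ?(ltW p0) ?(ltW nR)//= ler_pdivrMr//.
  by rewrite ler_peMr ?(ltW p0)// ler1n.
rewrite mulf_eq0 (negbTE psiy)/= gt_eqF// sin_gt0_pi//.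
rewrite mulr_gt0 ?divr_gt0//= mulrA ltr_pdivrMr// mulrC ltr_pM2l// ltr_nat//.
Qed.

End Counting.

Lemma exists_kernel2 {R : realFieldType} (a b c d : R) : a * d - b * c = 0 ->
  exists x y : R, [/\ (x != 0) || (y != 0), a * x + b * y = 0 & c * x + d * y = 0].
Proof.
move=> D0.
have [/eqP|ab0] := boolP ((a == 0) && (b == 0)); last first.
  exists b, (- a); split; last by rewrite -[RHS]oppr0 -D0; ring.
    by rewrite oppr_eq0 orbC; move: ab0; rewrite negb_and.
  by ring.
move/eqP => /andP[/eqP-> /eqP->].
have [/andP[/eqP-> /eqP->]|cd0] := boolP ((c == 0) && (d == 0)).
  by exists 1, 0; rewrite oner_eq0 !mul0r !addr0.
exists d, (- c); split; last by ring.
  by rewrite oppr_eq0 orbC; move: cd0; rewrite negb_and.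
by rewrite !mul0r addr0.
Qed.

(** * The differential equation of the profile, and its nontriviality *)

Section ProfileEquation.
Context {R : realType}.
Variables (l p d q M : R).
Hypothesis qE : q ^+ 2 = d ^+ 2 + 2 * p ^+ 2 - 2 * M.
Local Notation Pr := (prof l (- p - d) (- p + d) p q).
Local Notation D := (profD (- p - d) (- p + d) p q).

(** The characteristic polynomial is [((r + p) ^+ 2 - d ^+ 2) * ((r - p) ^+ 2 + q ^+ 2)]: its cubic
    term cancels, and [qE] makes the quadratic coefficient [- 2 * M]. *)
Lemma prof_ode c y :
  Pr (D (D (D (D c)))) y - 2 * M * Pr (D (D c)) y
  + 4 * p * (d ^+ 2 + p ^+ 2 - M) * Pr (D c) y
  + (p ^+ 2 - d ^+ 2) * (p ^+ 2 + q ^+ 2) * Pr c y = 0.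
Proof.
have -> : M = (d ^+ 2 + 2 * p ^+ 2 - q ^+ 2) / 2 by rewrite qE; field.
by rewrite /prof /profD /=; field.
Qed.

Lemma prof_locally_eq0 r1 r2 c :
  (forall y, - l < y < l -> prof l r1 r2 p q c y = 0) ->
  forall y, - l < y < l -> prof l r1 r2 p q (profD r1 r2 p q c) y = 0.
Proof.
move=> c0 y yl; have [_ <-] := is_derive_prof l r1 r2 p q c y.
rewrite (@near_eq_derive _ _ _ _ (cst 0)) ?derive_cst ?oner_eq0//.
have yI : y \in `]- l, l[ by rewrite in_itv.
near=> z; apply: c0; have : z \in `]- l, l[ by near: z; exact: near_in_itvoo.
by rewrite in_itv.
Unshelve. all: by end_near.
Qed.

(** A profile vanishing on the interval has zero value and zero first three derivatives at 0; since
    [d] and [q] are nonzero, these isolate the two real modes. *)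
Lemma prof_neq0 c : 0 < l -> 0 < q -> d != 0 ->
  (c.1.1.1 != 0) || (c.1.1.2 != 0) -> exists2 y : R, - l < y < l & Pr c y != 0.
Proof.
move=> l0 q0 d0 c12; apply: contrapT => H.
have H0 y : - l < y < l -> Pr c y = 0.
  by move=> yl; apply/eqP/negPn/negP => ?; apply: H; exists y.
have H1 := prof_locally_eq0 _ _ _ H0.
have H2 := prof_locally_eq0 _ _ _ H1.
have H3 := prof_locally_eq0 _ _ _ H2.
have z0 : - l < 0 < l by rewrite oppr_lt0 l0.
move: {H0}(H0 0 z0) {H1}(H1 0 z0) {H2}(H2 0 z0) {H3}(H3 0 z0).
rewrite /prof /profD /=.
set e1 := expR ((- p - d) * _); set e2 := expR ((- p + d) * _).
set e := expR _; set co := cos _; set si := sin _ => E0 E1 E2 E3.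
have P0 (r : R) : 0 < (r - p) ^+ 2 + q ^+ 2.
  by rewrite ltr_wpDl ?sqr_ge0// exprn_gt0.
(* Applying r^2 - 2pr + (p^2 + q^2) as a differential operator removes the
   oscillating part; a further first-order operator isolates each real mode.
   The zeros below stand for the values in E0, E1, E2, E3. *)
pose N := p ^+ 2 + q ^+ 2.
have K1 : c.1.1.1 * e1 * (d * ((- p - d - p) ^+ 2 + q ^+ 2)) = 0.
  transitivity (- 2^-1 * (0 - 2 * p * 0 + N * 0 - (- p + d) * (0 - 2 * p * 0 + N * 0)) : R).
    by rewrite -{1}E3 -{1}E2 -{1}E1 -{1}E2 -{1}E1 -E0 /N; field.
  by ring.
have K2 : c.1.1.2 * e2 * (d * ((- p + d - p) ^+ 2 + q ^+ 2)) = 0.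
  transitivity (2^-1 * (0 - 2 * p * 0 + N * 0 - (- p - d) * (0 - 2 * p * 0 + N * 0)) : R).
    by rewrite -{1}E3 -{1}E2 -{1}E1 -{1}E2 -{1}E1 -E0 /N; field.
  by ring.
move/eqP: K1; rewrite !mulf_eq0 (negbTE d0) (gt_eqF (P0 _)) (gt_eqF (expR_gt0 _)) !orbF => c1.
move/eqP: K2; rewrite !mulf_eq0 (negbTE d0) (gt_eqF (P0 _)) (gt_eqF (expR_gt0 _)) !orbF => c2.
by move: c12; rewrite c1 c2.
Qed.
End ProfileEquation.

(** * Pointwise continuity by recursion on syntax *)

Section ContinuousAt.
Context {R : realType}.
Implicit Types (f g : R -> R) (x : R).

Definition cont_at x f : Prop := {for x, continuous f}.

Lemma cont_at_cst x (k : R) : cont_at x (fun=> k).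
Proof. exact: cvg_cst. Qed.

Lemma cont_at_id x : cont_at x (fun y => y).
Proof. exact: cvg_id. Qed.

Lemma cont_atD x f g : cont_at x f -> cont_at x g -> cont_at x (fun y => f y + g y).
Proof. exact: cvgD. Qed.

Lemma cont_atN x f : cont_at x f -> cont_at x (fun y => - f y).
Proof. exact: cvgN. Qed.

Lemma cont_atM x f g : cont_at x f -> cont_at x g -> cont_at x (fun y => f y * g y).
Proof. exact: cvgM. Qed.

Lemma cont_atX x f n : cont_at x f -> cont_at x (fun y => f y ^+ n).
Proof.
move=> cf; elim: n => [|n IH]; first exact: cont_at_cst.
rewrite (_ : (fun y => _) = fun y => f y * f y ^+ n); first exact: cont_atM.
by apply/funext => y; rewrite exprS.
Qed.

Lemma cont_atV x f : cont_at x f -> f x != 0 -> cont_at x (fun y => (f y)^-1).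
Proof. by move=> cf fx; apply: cvgV. Qed.

Lemma cont_at_comp x (h : R -> R) f :
  continuous h -> cont_at x f -> cont_at x (fun y => h (f y)).
Proof. by move=> ch cf; exact: (@continuous_comp _ _ _ f h x cf (ch (f x))). Qed.
End ContinuousAt.

(** Inverses have no case of their own: their continuity needs a nonzero denominator and is supplied
    as a hypothesis. *)
Local Ltac continuity :=
  repeat lazymatch goal with
  | H : cont_at ?x ?f |- cont_at ?x ?f => exact H
  | |- cont_at _ (fun y => y) => exact: cont_at_id
  | |- cont_at _ (fun _ => ?k) => exact: cont_at_cst
  | |- cont_at _ (fun y => @GRing.add _ (@?f y) (@?g y)) => refine (cont_atD _ f g _ _)
  | |- cont_at _ (fun y => @GRing.opp _ (@?f y)) => refine (cont_atN _ f _)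
  | |- cont_at _ (fun y => @GRing.mul _ (@?f y) (@?g y)) => refine (cont_atM _ f g _ _)
  | |- cont_at _ (fun y => @GRing.exp _ (@?f y) ?n) => refine (cont_atX _ f n _)
  | |- cont_at _ (fun y => expR (@?f y)) =>
      refine (cont_at_comp _ expR f _ _); [exact: continuous_expR|]
  | |- cont_at _ (fun y => cos (@?f y)) =>
      refine (cont_at_comp _ cos f _ _); [exact: continuous_cos|]
  | |- cont_at _ (fun y => sin (@?f y)) =>
      refine (cont_at_comp _ sin f _ _); [exact: continuous_sin|]
  | |- cont_at _ (fun y => Num.sqrt (@?f y)) =>
      refine (cont_at_comp _ Num.sqrt f _ _); [exact: sqrt_continuous|]
  end; try eassumption.

(** * Elimination at [y = l] and the determinant at [y = - l] *)

Section BoundaryDeterminant.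
Context {R : realType}.
Variables (l s t : R).
Implicit Types (p d q r : R).

(* The moment and shear conditions applied to exp (r y) produce the
   polynomials bcA r and bcB r; reA + i imA and reB + i imB are their values at
   r = p + i q. *)
Definition bcA r : R := r ^+ 2 - s.
Definition bcB r : R := r ^+ 3 - t * r.
Definition reA p q : R := p ^+ 2 - q ^+ 2 - s.
Definition imA p q : R := 2 * p * q.
Definition reB p q : R := p ^+ 3 - 3 * p * q ^+ 2 - t * p.
Definition imB p q : R := 3 * p ^+ 2 * q - q ^+ 3 - t * q.
(** Determinant of the two conditions at [y = l] in the two oscillating coefficients; [cosc] and
    [sinc] follow by Cramer's rule. *)
Definition rdet p q : R := reA p q * imB p q - imA p q * reB p q.

(* Coefficients of the oscillating part for which exp (r (y + l)) plus that
   part satisfies both conditions at y = l. *)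
Definition cosc p q r : R :=
  expR (r * (l + l)) * (bcB r * imA p q - bcA r * imB p q) / rdet p q.
Definition sinc p q r : R :=
  expR (r * (l + l)) * (bcA r * reB p q - bcB r * reA p q) / rdet p q.

(** Value at [y = - l] of the operator with symbol [x + i y] on the oscillating part attached to the
    real mode [r]. The prefactor makes it exponentially small in [p]. *)
Definition tail p q (x y r : R) : R :=
  expR (p * (- l - l)) *
  ((x * cosc p q r + y * sinc p q r) * cos (q * (- l - l)) +
   (x * sinc p q r - y * cosc p q r) * sin (q * (- l - l))).

Definition leftA p q r : R := bcA r + tail p q (reA p q) (imA p q) r.
Definition leftB p q r : R := bcB r + tail p q (reB p q) (imB p q) r.

Definition bdet p d q : R :=
  leftA p q (- p - d) * leftB p q (- p + d) -
  leftA p q (- p + d) * leftB p q (- p - d).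

(** A kernel vector weights the two corrected real modes. The conditions at [y = - l] are the kernel
    equations; those at [y = l] hold for each corrected mode separately. *)
Lemma boundary_kernel p d q : rdet p q != 0 -> bdet p d q = 0 ->
  exists c : R * R * R * R, (c.1.1.1 != 0) || (c.1.1.2 != 0) /\
  forall y, y = - l \/ y = l ->
    prof l (- p - d) (- p + d) p q
      (profD (- p - d) (- p + d) p q (profD (- p - d) (- p + d) p q c)) y
    = s * prof l (- p - d) (- p + d) p q c y /\
    prof l (- p - d) (- p + d) p q
      (profD (- p - d) (- p + d) p q (profD (- p - d) (- p + d) p q
        (profD (- p - d) (- p + d) p q c))) y
    = t * prof l (- p - d) (- p + d) p q (profD (- p - d) (- p + d) p q c) y.
Proof.
move=> D0 F0; have [x [y [xy0 HA HB]]] := exists_kernel2 _ _ _ _ F0.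
exists (x, y, x * cosc p q (- p - d) + y * cosc p q (- p + d),
        x * sinc p q (- p - d) + y * sinc p q (- p + d)); split => // z [->|->].
- rewrite /prof /profD /= addNr !mulr0 expR0; split; apply/eqP; rewrite -subr_eq0; apply/eqP.
    rewrite -[RHS]HA /leftA /tail /reA /imA /bcA; ring.
  rewrite -[RHS]HB /leftB /tail /reB /imB /bcB; ring.
- have EA r : reA p q * cosc p q r + imA p q * sinc p q r = - (expR (r * (l + l)) * bcA r).
    by rewrite /cosc /sinc; move: D0; rewrite /rdet => D0; field.
  have EB r : reB p q * cosc p q r + imB p q * sinc p q r = - (expR (r * (l + l)) * bcB r).
    by rewrite /cosc /sinc; move: D0; rewrite /rdet => D0; field.
  rewrite /prof /profD /= subrr !mulr0 expR0 cos0 sin0; split;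
    apply/eqP; rewrite -subr_eq0; apply/eqP.
    transitivity (x * (reA p q * cosc p q (- p - d) + imA p q * sinc p q (- p - d)
        + expR ((- p - d) * (l + l)) * bcA (- p - d))
      + y * (reA p q * cosc p q (- p + d) + imA p q * sinc p q (- p + d)
        + expR ((- p + d) * (l + l)) * bcA (- p + d))).
      by rewrite /reA /imA /bcA; ring.
    by rewrite !EA; ring.
  transitivity (x * (reB p q * cosc p q (- p - d) + imB p q * sinc p q (- p - d)
      + expR ((- p - d) * (l + l)) * bcB (- p - d))
    + y * (reB p q * cosc p q (- p + d) + imB p q * sinc p q (- p + d)
      + expR ((- p + d) * (l + l)) * bcB (- p + d))).
    by rewrite /reB /imB /bcB; ring.
  by rewrite !EB; ring.
Qed.

Lemma cont_at_bdet (x : R) (P D Q : R -> R) :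
  cont_at x P -> cont_at x D -> cont_at x Q -> rdet (P x) (Q x) != 0 ->
  cont_at x (fun y => bdet (P y) (D y) (Q y)).
Proof.
move=> cP cD cQ D0.
have cdet : cont_at x (fun y => (rdet (P y) (Q y))^-1).
  by apply: cont_atV => //; rewrite /rdet /reA /imA /reB /imB; continuity.
have cco (r : R -> R) : cont_at x r -> cont_at x (fun y => cosc (P y) (Q y) (r y)).
  by move=> cr; rewrite /cosc /imA /imB /bcA /bcB; continuity.
have csi (r : R -> R) : cont_at x r -> cont_at x (fun y => sinc (P y) (Q y) (r y)).
  by move=> cr; rewrite /sinc /reA /reB /bcA /bcB; continuity.
have cl : cont_at x (fun y => - P y - D y) by continuity.
have cr : cont_at x (fun y => - P y + D y) by continuity.
have := cco _ cl; have := csi _ cl; have := cco _ cr; have := csi _ cr.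
rewrite /bdet /leftA /leftB /tail /reA /reB /imA /imB /bcA /bcB.
by move=> csr ccr csl ccl; continuity.
Qed.
End BoundaryDeterminant.

(** * Bounds on the boundary terms: order [p ^+ 2] for moment, [p ^+ 3] for shear *)

Section BoundaryEstimate.
Context {R : realType}.
Variables (l s t M p q : R).

Record admissible : Prop := Admissible {
  adm_s : 0 <= s <= M; adm_t : 0 <= t <= 2 * M; adm_p : 1 <= p;
  adm_pM : 10 * M <= p ^+ 2; adm_q : 0 < q; adm_pq : p ^+ 2 <= q ^+ 2 }.

(** After factoring out [q >= p], the square [(p ^+ 2 + q ^+ 2) ^+ 2 >= 4 * p ^+ 4] dominates the
    only possibly negative term, which costs at most [2 * p ^+ 4]. *)
Lemma rdet_ge : admissible -> p ^+ 5 <= rdet s t p q.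
Proof.
move=> [/andP[s0 sM] /andP[t0 tM] p1 pM q0 pq]; have p0 : 0 < p by lra.
have qp : p <= q by rewrite -ler_sqr ?nnegrE ?(ltW p0) ?(ltW q0).
have X0 : 0 <= p ^+ 2 by apply: sqr_ge0.
have -> : rdet s t p q = q * ((p ^+ 2 + q ^+ 2) ^+ 2 + t * (p ^+ 2 + q ^+ 2)
    - s * (3 * p ^+ 2 - q ^+ 2) + s * t).
  by rewrite /rdet /reA /imA /reB /imB; ring.
have -> : p ^+ 5 = p * (p ^+ 2) ^+ 2 by ring.
move: (p ^+ 2) (q ^+ 2) pM pq X0 => X Y XM XY X0.
have H1 : 0 <= t * (X + Y) by apply: mulr_ge0; lra.
have H2 : 0 <= s * t by apply: mulr_ge0.
have H3 : s * (3 * X - Y) <= X * (2 * X).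
  apply: (@le_trans _ _ (s * (2 * X))); first by apply: ler_wpM2l => //; lra.
  by apply: ler_wpM2r; lra.
have H4 : (2 * X) ^+ 2 <= (X + Y) ^+ 2 by rewrite ler_sqr ?nnegrE; lra.
apply: ler_pM => //; [exact: ltW|exact: sqr_ge0|].
have H5 : (2 * X) ^+ 2 = 2 * (X * (2 * X)) by ring.
have H6 : X * (2 * X) = 2 * X ^+ 2 by ring.
have := sqr_ge0 X; lra.
Qed.

Hypotheses (adm : admissible) (qp3 : q ^+ 2 <= 3 * p ^+ 2).

Lemma norm_reA : `|reA s p q| <= 4 * p ^+ 2.
Proof.
move: adm qp3 => [/andP[s0 sM] /andP[t0 tM] p1 pM q0 pq] qp.
by rewrite ler_norml /reA; apply/andP; split; lra.
Qed.

Lemma q_le2p : q <= 2 * p.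
Proof.
move: adm qp3 => [/andP[s0 sM] /andP[t0 tM] p1 pM q0 pq] qp.
rewrite -ler_sqr ?nnegrE; [|lra|lra].
by rewrite exprMn; have := sqr_ge0 p; lra.
Qed.

Lemma norm_imA : `|imA p q| <= 4 * p ^+ 2.
Proof.
move: adm => [_ _ p1 _ q0 _]; have p0 : 0 < p by lra.
have -> : 4 * p ^+ 2 = 2 * p * (2 * p) by ring.
rewrite /imA ger0_norm ?mulr_ge0 ?(ltW p0) ?(ltW q0)//.
by rewrite ler_pM2l ?mulr_gt0//; exact: q_le2p.
Qed.

Lemma norm_reB : `|reB t p q| <= 9 * p ^+ 3.
Proof.
move: adm qp3 => [/andP[s0 sM] /andP[t0 tM] p1 pM q0 pq] qp.
have p0 : 0 < p by lra.
have -> : reB t p q = p * (p ^+ 2 - 3 * q ^+ 2 - t) by rewrite /reB; ring.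
have -> : 9 * p ^+ 3 = p * (9 * p ^+ 2) by ring.
rewrite normrM gtr0_norm// ler_pM2l// ler_norml; apply/andP; split; lra.
Qed.

Lemma norm_imB : `|imB t p q| <= 9 * p ^+ 3.
Proof.
have q2p := q_le2p.
move: adm qp3 => [/andP[s0 sM] /andP[t0 tM] p1 pM q0 pq] qp.
have p0 : 0 < p by lra.
have -> : imB t p q = q * (3 * p ^+ 2 - q ^+ 2 - t) by rewrite /imB; ring.
have -> : 9 * p ^+ 3 = (2 * p) * (9 / 2 * p ^+ 2) by field.
rewrite normrM gtr0_norm//; apply: ler_pM => //; first exact: ltW.
by rewrite ler_norml; apply/andP; split; lra.
Qed.

Variable r : R.
Hypotheses (l0 : 0 < l) (r0 : - (2 * p) <= r <= 0).

Lemma root_sqr_le : r ^+ 2 <= 4 * p ^+ 2.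
Proof.
move: r0 => /andP[H1 H2].
have -> : 4 * p ^+ 2 = (2 * p) ^+ 2 by ring.
by rewrite -sqrrN ler_sqr ?nnegrE; lra.
Qed.

Lemma norm_bcA : `|bcA s r| <= 4 * p ^+ 2.
Proof.
move: adm root_sqr_le (sqr_ge0 r) => [/andP[s0 sM] /andP[t0 tM] p1 pM q0 pq] ? ?.
by rewrite ler_norml /bcA; apply/andP; split; lra.
Qed.

Lemma norm_bcB : `|bcB t r| <= 9 * p ^+ 3.
Proof.
move: adm r0 root_sqr_le (sqr_ge0 r).
move=> [/andP[s0 sM] /andP[t0 tM] p1 pM q0 pq] /andP[H1 H2] ? ?.
have p0 : 0 < p by lra.
have -> : bcB t r = r * (r ^+ 2 - t) by rewrite /bcB; ring.
have -> : 9 * p ^+ 3 = (2 * p) * (9 / 2 * p ^+ 2) by field.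
rewrite normrM; apply: ler_pM => //; rewrite ler_norml; apply/andP; split; lra.
Qed.

(** The numerator is at most [2 * (4 * p ^+ 2) * (9 * p ^+ 3) = 72 * p ^+ 5], the denominator at
    least [p ^+ 5], and the exponential at most 1 as [r <= 0]. *)
Lemma norm_osc (A B a b : R) : `|A| <= 4 * p ^+ 2 -> `|a| <= 4 * p ^+ 2 ->
  `|B| <= 9 * p ^+ 3 -> `|b| <= 9 * p ^+ 3 ->
  `|expR (r * (l + l)) * (A * b - B * a) / rdet s t p q| <= 72.
Proof.
move=> HA Ha HB Hb; have D5 := rdet_ge adm.
move: adm r0 => [_ _ p1 _ _ _] /andP[H1 H2].
have p5 : 0 < p ^+ 5 by rewrite exprn_gt0; lra.
have D0 := lt_le_trans p5 D5.
rewrite normrM normfV (gtr0_norm D0) ler_pdivrMr// normrM gtr0_norm ?expR_gt0//.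
apply: (@le_trans _ _ (1 * (72 * p ^+ 5))); last by rewrite mul1r ler_pM2l.
apply: ler_pM; rewrite ?expR_ge0//.
  by rewrite -expR0 ler_expR mulr_le0_ge0// addr_ge0// ltW.
apply: (le_trans (ler_normB _ _)); rewrite !normrM.
have -> : 72 * p ^+ 5 = 4 * p ^+ 2 * (9 * p ^+ 3) + 9 * p ^+ 3 * (4 * p ^+ 2) by ring.
by apply: lerD; apply: ler_pM.
Qed.

Lemma norm_cosc : `|cosc l s t p q r| <= 72.
Proof.
have := norm_osc (bcA s r) (bcB t r) (imA p q) (imB t p q)
  norm_bcA norm_imA norm_bcB norm_imB.
by rewrite -normrN -mulNr -mulrN opprB.
Qed.

Lemma norm_sinc : `|sinc l s t p q r| <= 72.
Proof. exact: norm_osc norm_bcA norm_reA norm_bcB norm_reB. Qed.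

(** Four products, each at most [9 * p ^+ 3 * 72], times the decaying exponential. *)
Lemma norm_tail x y : `|x| <= 9 * p ^+ 3 -> `|y| <= 9 * p ^+ 3 ->
  `|tail l s t p q x y r| <= 2592 * p ^+ 3 * expR (- (2 * l * p)).
Proof.
move=> Hx Hy.
rewrite /tail normrM gtr0_norm ?expR_gt0// mulrC.
have -> : p * (- l - l) = - (2 * l * p) by ring.
apply: ler_wpM2r; first exact: expR_ge0.
have K (u v u' v' w : R) : `|u| <= 9 * p ^+ 3 -> `|v| <= 9 * p ^+ 3 ->
    `|u'| <= 72 -> `|v'| <= 72 -> `|w| <= 1 -> `|(u * u' + v * v') * w| <= 1296 * p ^+ 3.
  move=> Hu Hv Hu' Hv' Hw.
  have -> : 1296 * p ^+ 3 = (9 * p ^+ 3 * 72 + 9 * p ^+ 3 * 72) * 1 by ring.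
  rewrite normrM; apply: ler_pM => //.
  apply: (le_trans (ler_normD _ _)); rewrite !normrM.
  by apply: lerD; apply: ler_pM.
have -> : 2592 * p ^+ 3 = 1296 * p ^+ 3 + 1296 * p ^+ 3 by ring.
apply: (le_trans (ler_normD _ _)); apply: lerD.
  by apply: K => //; [exact: norm_cosc|exact: norm_sinc|exact: cos_max].
by rewrite -mulrN; apply: K; rewrite ?normrN//; [exact: norm_sinc|exact: norm_cosc|exact: sin_max].
Qed.

End BoundaryEstimate.

(** * Asymptotics of the determinant for fixed [rho = p - d] *)

Section Endpoint.
Context {R : realType}.
Variables (l s t M : R).
Hypotheses (l0 : 0 < l) (sM : 0 <= s <= M) (tM : 0 <= t <= 2 * M).

(** Keep only the term [x ^+ 5 / 5!] of the exponential series at [x = 2 * l * p]. The fifth power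
    is what later gives [p * e <= 1] for a tail bound [e] of order [p ^+ 3] times the
    exponential. *)
Lemma exp_decay5 (p : R) : 0 < p ->
  p ^+ 5 * expR (- (2 * l * p)) <= 120 / (2 * l) ^+ 5.
Proof.
move=> p0; have lp0 : 0 < 2 * l * p by rewrite !mulr_gt0.
have := expR_ge1Dxn 4 (ltW lp0); rewrite expRN => H.
have {}H : (2 * l * p) ^+ 5 / 120 <= expR (2 * l * p).
  by apply: le_trans H; rewrite lerDr.
rewrite ler_pdivrMr ?expR_gt0// mulrAC ler_pdivlMr ?exprn_gt0 ?mulr_gt0//.
by move: H; rewrite ler_pdivrMr// exprMn mulrC [_ * 120]mulrC.
Qed.

(* The main term comes from the two real modes at y = - l; everything else is
   exponentially small. *)
Lemma bdet_asymptotic (rho p q : R) :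
  0 < rho -> rho <= p -> 1 <= p -> 10 * M <= p ^+ 2 ->
  2592 * (120 / (2 * l) ^+ 5) <= p -> 0 < q ->
  q ^+ 2 = (p - rho) ^+ 2 + 2 * p ^+ 2 - 2 * M ->
  `|bdet l s t p (p - rho) q - bcA s rho * ((2 * p - rho) * ((2 * p - rho) ^+ 2 - t))|
    <= p ^+ 2 * (15 + 5 * `|bcB t rho| + `|bcA s rho|).
Proof.
move=> rho0 rhop p1 pM pl q0 qE; have p0 : 0 < p by lra.
have p2 : 0 < p ^+ 2 by rewrite exprn_gt0.
have p3 : 0 < p ^+ 3 by rewrite exprn_gt0.
have pq : p ^+ 2 <= q ^+ 2 by rewrite qE; have := sqr_ge0 (p - rho); move: sM => /andP[]; lra.
have qp3 : q ^+ 2 <= 3 * p ^+ 2.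
  have : (p - rho) ^+ 2 <= p ^+ 2.
    by rewrite ler_sqr ?nnegrE; clear -l0 sM tM rho0 rhop p0; lra.
  by rewrite qE; move: sM => /andP[]; lra.
have adm : admissible s t M p q by split.
have b1 : - (2 * p) <= - (2 * p - rho) <= 0.
  by clear -l0 sM tM rho0 rhop p0; apply/andP; split; lra.
have b2 : - (2 * p) <= - rho <= 0.
  by clear -l0 sM tM rho0 rhop p0; apply/andP; split; lra.
pose e := 2592 * p ^+ 3 * expR (- (2 * l * p)).
have e0 : 0 <= e := mulr_ge0 (mulr_ge0 (ler0n _ _) (ltW p3)) (expR_ge0 _).
have pe : p * e <= 1.
  rewrite -(ler_pM2l p0) mulr1; apply: le_trans pl.
  rewrite [leLHS](_ : _ = 2592 * (p ^+ 5 * expR (- (2 * l * p)))); last by rewrite /e; ring.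
  by apply: ler_wpM2l; [exact: ler0n|exact: exp_decay5].
have e1 : e <= 1 by apply: le_trans pe; rewrite ler_peMl.
have p23 : 4 * p ^+ 2 <= 9 * p ^+ 3.
  have : p ^+ 2 * 1 <= p ^+ 2 * p by rewrite ler_pM2l.
  have -> : p ^+ 3 = p ^+ 2 * p by ring.
  lra.
have rA : `|reA s p q| <= 9 * p ^+ 3 := le_trans (norm_reA _ _ _ _ _ adm qp3) p23.
have iA : `|imA p q| <= 9 * p ^+ 3 := le_trans (norm_imA _ _ _ _ _ adm qp3) p23.
have rB := norm_reB _ _ _ _ _ adm qp3; have iB := norm_imB _ _ _ _ _ adm qp3.
have A1b := norm_bcA _ _ _ _ _ adm _ b1; have B1b := norm_bcB _ _ _ _ _ adm _ b1.
rewrite /bdet /leftA /leftB (_ : - p - (p - rho) = - (2 * p - rho)); last by ring.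
rewrite (_ : - p + (p - rho) = - rho); last by ring.
have -> : bcA s (- rho) = bcA s rho by rewrite /bcA sqrrN.
have -> : bcB t (- rho) = - bcB t rho by rewrite /bcB; ring.
have vB : (2 * p - rho) * ((2 * p - rho) ^+ 2 - t) = - bcB t (- (2 * p - rho)).
  by rewrite /bcB; ring.
rewrite vB.
move: (norm_tail _ _ _ _ _ _ adm qp3 _ l0 b1 _ _ rA iA) => d1.
move: (norm_tail _ _ _ _ _ _ adm qp3 _ l0 b1 _ _ rB iB) => d3.
move: (norm_tail _ _ _ _ _ _ adm qp3 _ l0 b2 _ _ rA iA) => d2.
move: (norm_tail _ _ _ _ _ _ adm qp3 _ l0 b2 _ _ rB iB) => d4.
rewrite -/e in d1 d2 d3 d4; move: d1 d2 d3 d4.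
set D1 := tail _ _ _ _ _ _ _ _; set D2 := tail _ _ _ _ _ _ _ _.
set D3 := tail _ _ _ _ _ _ _ _; set D4 := tail _ _ _ _ _ _ _ _ => d1 d2 d3 d4.
move: (bcA s (- _)) (bcB t (- _)) (bcA s rho) (bcB t rho) A1b B1b => A1 B1 A2 B2 A1b B1b.
(* Subtracting the main term leaves seven products. [A1 * B2] contains no tail, but [B2] depends
   only on [rho], so it is of order [p ^+ 2], against [p ^+ 3] for the main term. *)
rewrite [X in `|X|](_ : _ = - (A1 * B2) + A1 * D4 - D1 * B2 + D1 * D4
  - A2 * D3 - D2 * B1 - D2 * D3); last by ring.
have p21 : 1 <= p ^+ 2 by rewrite exprn_ege1.
have bd (x y u v : R) : `|x| <= u -> `|y| <= v -> `|x * y| <= u * v.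
  by move=> *; rewrite normrM ler_pM.
have T1 : `|A1 * B2| <= p ^+ 2 * (4 * `|B2|).
  by rewrite mulrCA mulrA; exact: bd.
have T2 : `|A1 * D4| <= p ^+ 2 * 4.
  apply: le_trans (bd _ _ _ _ A1b d4) _; rewrite [leRHS]mulrC.
  by apply: ler_piMr => //; rewrite mulr_ge0// ltW.
have T3 : `|D1 * B2| <= p ^+ 2 * `|B2|.
  by rewrite normrM ler_pM// (le_trans d1)// (le_trans e1).
have T4 : `|D1 * D4| <= p ^+ 2 * 1.
  by rewrite normrM ler_pM// ?(le_trans d1)// ?(le_trans d4)// (le_trans e1).
have T5 : `|A2 * D3| <= p ^+ 2 * `|A2|.
  by rewrite mulrC normrM ler_pM// (le_trans d3)// (le_trans e1).
have T6 : `|D2 * B1| <= p ^+ 2 * 9.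
  apply: le_trans (bd _ _ _ _ d2 B1b) _.
  have -> : e * (9 * p ^+ 3) = p ^+ 2 * 9 * (p * e) by ring.
  by apply: ler_piMr => //; rewrite mulr_ge0// ltW.
have T7 : `|D2 * D3| <= p ^+ 2 * 1.
  by rewrite normrM ler_pM// ?(le_trans d2)// ?(le_trans d3)// (le_trans e1).
have -> : p ^+ 2 * (15 + 5 * `|B2| + `|A2|) =
    p ^+ 2 * (4 * `|B2|) + p ^+ 2 * 4 + p ^+ 2 * `|B2| + p ^+ 2 * 1
    + p ^+ 2 * `|A2| + p ^+ 2 * 9 + p ^+ 2 * 1 by ring.
do 3 (apply: (le_trans (ler_normB _ _)); apply: lerD => //).
apply: (le_trans (ler_normD _ _)); apply: lerD => //.
apply: (le_trans (ler_normB _ _)); apply: lerD => //.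
by apply: (le_trans (ler_normD _ _)); apply: lerD => //; rewrite normrN.
Qed.
End Endpoint.

(** * Sign of the determinant for large [p] *)

Section DeterminantSign.
Context {R : realType}.
Variables (l s t M : R).
Hypotheses (l0 : 0 < l) (sM : 0 <= s <= M) (tM : 0 <= t <= 2 * M).

Lemma bdet_sign (rho : R) : 0 < rho -> bcA s rho != 0 ->
  exists P : R, forall p q, P <= p -> 0 < q ->
    q ^+ 2 = (p - rho) ^+ 2 + 2 * p ^+ 2 - 2 * M ->
    0 < bcA s rho * bdet l s t p (p - rho) q.
Proof.
move=> rho0 A0; set A := bcA s rho in A0 *.
pose K := 15 + 5 * `|bcB t rho| + `|A|.
pose e := 2592 * (120 / (2 * l) ^+ 5).
have K0 : 0 < K by rewrite /K; have := normr_ge0 (bcB t rho); have := normr_ge0 A; lra.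
have nA : 0 < `|A| by rewrite normr_gt0.
have e0 : 0 <= e by rewrite mulr_ge0 ?ler0n// divr_ge0 ?ler0n// exprn_ge0// mulr_ge0// ltW.
have KA0 : 0 < 2 * K / `|A| by rewrite divr_gt0// mulr_gt0.
have M0 : 0 <= M by move: sM => /andP[]; exact: le_trans.
(* Each summand secures one requirement: [rho <= p], [1 <= p], [10 * M <= p ^+ 2], small tails, and
   a main term of size [p ^+ 3 / 2] beating the error [p ^+ 2 * K]. *)
exists (rho + 1 + 10 * M + e + 2 * K / `|A|) => p q pP q0 qE.
have p1 : 1 <= p by lra.
have rhop : rho <= p by lra.
have p0 : 0 < p by lra.
have pe : e <= p by lra.
have pM : 10 * M <= p ^+ 2.
  have : p * 1 <= p * p by rewrite ler_pM2l.
  by rewrite -expr2; lra.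
have pK : 2 * K < p * `|A| by rewrite -ltr_pdivrMr//; lra.
have := bdet_asymptotic l s t M l0 sM tM rho p q rho0 rhop p1 pM pe q0 qE.
rewrite -/A -/K; set W := (2 * p - rho) * _; set F := bdet _ _ _ _ _ _ => H.
have W0 : p ^+ 3 / 2 <= W.
  have -> : p ^+ 3 / 2 = p * (p ^+ 2 / 2) by field.
  apply: ler_pM; [exact: ltW|by rewrite divr_ge0 ?sqr_ge0|clear -l0 sM tM rhop; lra|].
  have : p ^+ 2 <= (2 * p - rho) ^+ 2.
    by rewrite ler_sqr ?nnegrE; clear -l0 sM tM rho0 rhop p0; lra.
  by move: tM => /andP[]; lra.
have H2 : - (`|A| * (p ^+ 2 * K)) <= A * (F - A * W).
  have : `|A * (F - A * W)| <= `|A| * (p ^+ 2 * K) by rewrite normrM ler_pM2l.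
  by rewrite ler_norml => /andP[].
have H3 : A * (A * W) = `|A| * (`|A| * W).
  by rewrite !mulrA -!expr2 real_normK// num_real.
have H4 : `|A| * (p ^+ 2 * K) < `|A| * (`|A| * W).
  rewrite ltr_pM2l//; apply: lt_le_trans (_ : `|A| * (p ^+ 3 / 2) <= _); last by rewrite ler_pM2l.
  have -> : `|A| * (p ^+ 3 / 2) = p ^+ 2 * (p * `|A| / 2) by field.
  by rewrite ltr_pM2l ?exprn_gt0//; lra.
have -> : A * F = A * (F - A * W) + A * (A * W) by ring.
lra.
Qed.
End DeterminantSign.

(* 4p((p - rho)^2 + p^2 - M) is the value of - alpha for which the
   characteristic roots are - rho, rho - 2p and p +- i q. *)
Lemma speed_root {R : realType} (M rho a b : R) :
  1 <= b -> M + 1 <= b -> 4 * b * ((b - rho) ^+ 2 + b ^+ 2 - M) <= a ->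
  exists2 p, b <= p & 4 * p * ((p - rho) ^+ 2 + p ^+ 2 - M) = a.
Proof.
move=> b1 bM ba; pose f p : R := 4 * p * ((p - rho) ^+ 2 + p ^+ 2 - M).
have cf : continuous f.
  move=> x; have : cont_at x f by rewrite /f; continuity.
  exact.
(* At [b + |a|] the bracket in [f] is at least 1, so [f] exceeds [a] there and the intermediate
   value theorem applies. *)
have bB : b <= b + `|a| by rewrite lerDl.
have faB : a <= f (b + `|a|).
  have BB : 1 <= b + `|a| by have := normr_ge0 a; lra.
  have BM : M + 1 <= b + `|a| by have := normr_ge0 a; lra.
  have aB : `|a| <= b + `|a| by lra.
  rewrite /f; move: (b + `|a|) BB BM aB => B BB BM aB.
  apply: (le_trans (ler_norm a)); apply: (le_trans aB).
  have B2 : B * 1 <= B * B by apply: ler_wpM2l; lra.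
  have : 4 * B * 1 <= 4 * B * ((B - rho) ^+ 2 + B ^+ 2 - M).
    by apply: ler_wpM2l; [lra|have := sqr_ge0 (B - rho); rewrite -expr2 in B2; lra].
  lra.
have [p pI fp] : exists2 p, p \in `[b, b + `|a|] & f p = a.
  apply: IVT => //; first exact: continuous_subspaceT.
  by rewrite ge_min ba/= le_max faB orbT.
by exists p => //; move: pI; rewrite in_itv => /andP[].
Qed.

(** * The path of constant [a] and the sign change along it *)

(** For fixed [a], the expression for [d ^+ 2] decreases in [p], so the endpoint values enclose
    it. *)
Lemma path_bounds {R : realFieldType} (M rho0 rho1 a p0 p1 p : R) :
  0 < p0 -> 0 <= a ->
  a / (4 * p0) = (p0 - rho0) ^+ 2 + p0 ^+ 2 - M ->
  a / (4 * p1) = (p1 - rho1) ^+ 2 + p1 ^+ 2 - M ->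
  p0 <= p <= p1 ->
  (p1 - rho1) ^+ 2 <= a / (4 * p) - p ^+ 2 + M <= (p0 - rho0) ^+ 2.
Proof.
move=> p00 a0 E0 E1 /andP[pl pr].
have pp : 0 < p := lt_le_trans p00 pl; have p10 : 0 < p1 := lt_le_trans pp pr.
have l1 : a / (4 * p) <= a / (4 * p0).
  by apply: ler_wpM2l => //; rewrite lef_pV2 ?posrE ?mulr_gt0// ler_pM2l.
have l2 : a / (4 * p1) <= a / (4 * p).
  by apply: ler_wpM2l => //; rewrite lef_pV2 ?posrE ?mulr_gt0// ler_pM2l.
have l3 : p0 ^+ 2 <= p ^+ 2 by rewrite ler_sqr ?nnegrE ?(ltW pp) ?(ltW p00).
have l4 : p ^+ 2 <= p1 ^+ 2 by rewrite ler_sqr ?nnegrE ?(ltW pp) ?(ltW p10).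
rewrite E0 in l1; rewrite E1 in l2; move: l1 l2 l3 l4.
move: (a / _) (p ^+ 2) (p0 ^+ 2) (p1 ^+ 2) ((p0 - _) ^+ 2) ((p1 - _) ^+ 2).
by clear => *; apply/andP; split; lra.
Qed.

(** Here [p ^+ 2 - d ^+ 2 = (p - d) * (p + d) >= rho * p > |K|], and the other factor is at least
    1. *)
Lemma stiffness_gt {R : realFieldType} (K rho p d q : R) :
  0 < rho -> 1 <= p -> `|K| / rho < p -> 0 <= d -> d <= p - rho ->
  K < (p ^+ 2 - d ^+ 2) * (p ^+ 2 + q ^+ 2).
Proof.
move=> rho0 p1 pK d0 dp.
have p0 : 0 < p := lt_le_trans ltr01 p1.
have Kp : `|K| < rho * p by rewrite mulrC -ltr_pdivrMr.
apply: (le_lt_trans (ler_norm K)); apply: (lt_le_trans Kp).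
rewrite -[leLHS]mulr1 (_ : p ^+ 2 - _ = (p - d) * (p + d)); last by ring.
apply: ler_pM => //; first by rewrite mulr_ge0// ltW.
  by apply: ler_pM; rewrite ?(ltW rho0) ?(ltW p0) ?lerDl// lerBrDr addrC -lerBrDr.
by rewrite -[leLHS]addr0; apply: lerD; rewrite ?sqr_ge0// exprn_ege1.
Qed.

Lemma profile_solution_exists {R : realType} (l sigma M K : R) :
  0 < l -> 0 < sigma < 1 -> 0 < M ->
  exists A : R, forall a, A < a -> exists r1 r2 p q k c,
    K < k /\ profile_solution l sigma r1 r2 p q M a k c.
Proof.
move=> l0 /andP[sigma0 sigma1] M0.
pose s := sigma * M; pose t := (2 - sigma) * M.
have s0 : 0 < s by rewrite mulr_gt0.
have sM : 0 <= s <= M by rewrite (ltW s0) /s ler_piMl// ltW.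
have tM : 0 <= t <= 2 * M.
  by rewrite /t mulr_ge0 ?(ltW M0)//=; [apply: ler_wpM2r; [exact: ltW|lra]|lra].
(* One value on each side of [Num.sqrt s], the positive zero of [bcA s]. *)
pose rho0 := Num.sqrt s / 2; pose rho1 := 2 * Num.sqrt s.
have sq0 : 0 < Num.sqrt s by rewrite sqrtr_gt0.
have sqE : Num.sqrt s ^+ 2 = s by rewrite sqr_sqrtr// ltW.
have r00 : 0 < rho0 by rewrite divr_gt0.
have r10 : 0 < rho1 by rewrite mulr_gt0.
have r01 : rho0 <= rho1 by rewrite /rho0 /rho1; lra.
have A0 : bcA s rho0 < 0 by rewrite /bcA /rho0 expr_div_n sqE; lra.
have A1 : 0 < bcA s rho1 by rewrite /bcA /rho1 exprMn sqE; lra.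
have [P0 HP0] := bdet_sign l s t M l0 sM tM rho0 r00 (ltr0_neq0 A0).
have [P1 HP1] := bdet_sign l s t M l0 sM tM rho1 r10 (lt0r_neq0 A1).
(* Beyond [b] both sign statements hold and the stiffness exceeds [K]. *)
pose b := Num.max (Num.max P0 P1) (rho1 + 1 + 10 * M + `|K| / rho0).
have KM : 0 <= `|K| / rho0 by rewrite divr_ge0// ltW.
have bb : rho1 + 1 + 10 * M + `|K| / rho0 <= b by rewrite le_max lexx orbT.
exists (4 * b * ((b - rho0) ^+ 2 + b ^+ 2 - M)) => a Aa.
have [|||p0 bp0 ap0] := @speed_root R M rho0 a b; [lra|lra|exact: ltW|].
have p00 : 0 < p0 by lra.
(* Since [rho0 <= rho1 <= p0], replacing [rho0] by [rho1] lowers the speed at [p0] to at most [a],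
   so [p1] can be sought to the right of [p0]. *)
have [|||p1 p01 ap1] := @speed_root R M rho1 a p0; [lra|lra| |].
  rewrite -ap0 ler_pM2l ?mulr_gt0// lerD2r lerD2r ler_sqr ?nnegrE; lra.
have p10 : 0 < p1 by lra.
(* [dd] and [qq] solve [a = 4 * p * (d ^+ 2 + p ^+ 2 - M)] and
   [q ^+ 2 = d ^+ 2 + 2 * p ^+ 2 - 2 * M] with [a] fixed. *)
pose dd (p : R) : R := Num.sqrt (a / (4 * p) - p ^+ 2 + M).
pose qq (p : R) : R := Num.sqrt (a / (4 * p) + p ^+ 2 - M).
have a0 : 0 <= a.
  rewrite -ap0 mulr_ge0 ?mulr_ge0 ?(ltW p00)//.
  have : p0 * 1 <= p0 * p0 by rewrite ler_pM2l//; lra.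
  by have := sqr_ge0 (p0 - rho0); rewrite -expr2; lra.
have aE0 : a / (4 * p0) = (p0 - rho0) ^+ 2 + p0 ^+ 2 - M by rewrite -ap0; field; rewrite gt_eqF.
have aE1 : a / (4 * p1) = (p1 - rho1) ^+ 2 + p1 ^+ 2 - M by rewrite -ap1; field; rewrite gt_eqF.
have p2M p : p0 <= p -> 10 * M <= p ^+ 2.
  move=> pl; have : p * 1 <= p * p by apply: ler_wpM2l; lra.
  by rewrite -expr2; lra.
have path p : p0 <= p <= p1 ->
    [/\ (p1 - rho1) ^+ 2 <= dd p ^+ 2 <= (p0 - rho0) ^+ 2,
       dd p ^+ 2 = a / (4 * p) - p ^+ 2 + M,
       qq p ^+ 2 = a / (4 * p) + p ^+ 2 - M, 0 < qq p & p ^+ 2 <= qq p ^+ 2].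
  move=> pI; have /andP[pl _] := pI.
  have b0 := path_bounds M rho0 rho1 a p0 p1 p p00 a0 aE0 aE1 pI.
  have dE : dd p ^+ 2 = a / (4 * p) - p ^+ 2 + M.
    by rewrite sqr_sqrtr//; apply: le_trans (andP b0).1; exact: sqr_ge0.
  have qE : p ^+ 2 <= a / (4 * p) + p ^+ 2 - M.
    have := p2M p pl; have := sqr_ge0 (dd p); rewrite dE.
    clear -M0; move: (p ^+ 2) (a / _) => X Y; lra.
  have X0 : 0 < p ^+ 2 by rewrite exprn_gt0// (lt_le_trans p00).
  have Y0 := lt_le_trans X0 qE.
  have qqE : qq p ^+ 2 = a / (4 * p) + p ^+ 2 - M by rewrite sqr_sqrtr// ltW.
  by split; rewrite ?dE ?qqE ?sqrtr_gt0.
have adm p : p0 <= p <= p1 -> admissible s t M p (qq p).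
  move=> pI; have [_ _ _ q0 pq] := path p pI; case/andP: pI => pl pr.
  by split => //; [lra|exact: p2M].
have p00I : p0 <= p0 <= p1 by rewrite lexx.
have p11I : p0 <= p1 <= p1 by rewrite lexx andbT.
have rdet_neq0 p : p0 <= p <= p1 -> rdet s t p (qq p) != 0.
  move=> pI; have := rdet_ge s t M p (qq p) (adm p pI).
  case/andP: pI => pl _; have p5 : 0 < p ^+ 5 by rewrite exprn_gt0//; lra.
  by move=> /(lt_le_trans p5); exact: lt0r_neq0.
have dd0 : dd p0 = p0 - rho0.
  rewrite /dd aE0 (_ : _ + M = (p0 - rho0) ^+ 2); last by ring.
  by rewrite sqrtr_sqr ger0_norm//; lra.
have dd1 : dd p1 = p1 - rho1.
  rewrite /dd aE1 (_ : _ + M = (p1 - rho1) ^+ 2); last by ring.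
  by rewrite sqrtr_sqr ger0_norm//; lra.
pose H (p : R) : R := bdet l s t p (dd p) (qq p).
have H0 : H p0 < 0.
  have [_ _ qE q0 _] := path p0 p00I.
  rewrite -(nmulr_rgt0 _ A0) /H dd0; apply: HP0 => //.
    by apply: le_trans bp0; rewrite !le_max lexx.
  by rewrite qE aE0; ring.
have H1 : 0 < H p1.
  have [_ _ qE q0 _] := path p1 p11I.
  rewrite -(pmulr_rgt0 _ A1) /H dd1; apply: HP1 => //.
    by apply: le_trans p01; apply: le_trans bp0; rewrite !le_max lexx orbT.
  by rewrite qE aE1; ring.
have cH : {within `[p0, p1], continuous H}.
  apply: continuous_in_subspaceT => x /[!inE] /=; rewrite in_itv /= => xI.
  have x0 : 0 < x by case/andP: xI => ? _; lra.
  have cV : cont_at x (fun y => (4 * y)^-1).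
    have c4 : cont_at x (fun y => 4 * y) by continuity.
    by apply: (cont_atV _ _ c4); rewrite mulf_neq0// gt_eqF.
  have cd : cont_at x dd by rewrite /dd; continuity.
  have cq : cont_at x qq by rewrite /qq; continuity.
  exact: (cont_at_bdet l s t x _ _ _ (cont_at_id x) cd cq (rdet_neq0 x xI)).
have [p pI Hp] : exists2 p, p \in `[p0, p1] & H p = 0.
  by apply: IVT => //; rewrite ge_min le_max (ltW H0) (ltW H1) orbT.
have {}pI : p0 <= p <= p1 by move: pI; rewrite in_itv.
have [dp ddE qqE q0 pq] := path p pI.
have [c [c12 BC]] := boundary_kernel l s t p (dd p) (qq p) (rdet_neq0 p pI) Hp.
case/andP: dp => dp1 dp2; case/andP: pI => pl pr.
have pp0 : 0 < p := lt_le_trans p00 pl.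
have rp : rho1 < p1 by clear -bb bp0 p01 M0 KM; lra.
(* Positivity of [dd p] separates the two real roots, as [prof_neq0] requires. *)
have d0 : 0 < dd p.
  by rewrite sqrtr_gt0; rewrite -ddE; apply: lt_le_trans dp1; rewrite exprn_gt0// subr_gt0.
have dp0 : dd p <= p - rho0.
  apply: (@le_trans _ _ (p0 - rho0)); last by rewrite lerD2r.
  by rewrite -ler_sqr ?nnegrE//; [exact: ltW|clear -bb bp0 r01 M0 KM; lra].
exists (- p - dd p), (- p + dd p), p, (qq p),
  ((p ^+ 2 - dd p ^+ 2) * (p ^+ 2 + qq p ^+ 2)), c; split.
  have [p1' pK] : 1 <= p /\ `|K| / rho0 < p.
    by clear -bb bp0 pl r10 M0 KM; split; lra.
  exact: (stiffness_gt _ _ _ _ _ r00 p1' pK (ltW d0) dp0).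
split.
- move=> y; rewrite -(@prof_ode _ l p (dd p) (qq p) M _ c y); last by rewrite ddE qqE; ring.
  do 2 congr (_ + _); congr (_ * _); rewrite ddE; field; rewrite gt_eqF//.
- by move=> y /BC[].
- by move=> y /BC[].
- apply: prof_neq0 => //; by rewrite gt_eqF.
Qed.

(** * Growth of the number of unimodal solutions *)

Theorem corollary3p8 (R : realType) (l sigma P S : R)
    (hl : 0 < l) (hsigma : 0 < sigma < 1) (hS : 0 < S) :
  number_unimodal_solutions l sigma P S alpha (cst 0) @[alpha --> -oo] --> +oo%E.
Proof.
apply/cvgeyPge => B; pose N := (Num.truncn `|B|).+1.
have BN : B <= N%:R by rewrite (le_trans (ler_norm B))// ltW// truncnS_gt.
(* Index [i] stands for the mode [m = i + 1]. Each mode has its own threshold in [alpha]; only [N]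
   of them are needed, so the thresholds can be met simultaneously. *)
have H (i : 'I_N) : \forall alpha \near -oo, exists (u : R * R -> R) (psi : R -> R),
    [/\ stationary_solution l sigma P S alpha (cst 0) u,
      exists2 y : R, - l <= y <= l & psi y != 0 &
      forall z, u z = psi z.2 * sin (i.+1%:R * z.1)].
  have i0 : 0 < i.+1%:R :> R by rewrite ltr0n.
  have [A HA] := @profile_solution_exists R l sigma (i.+1%:R ^+ 2)
    (i.+1%:R ^+ 4 - i.+1%:R ^+ 2 * P) hl hsigma (exprn_gt0 2 i0).
  exists (- A); split; first exact: num_real.
  move=> alpha alphaA.
  have [|r1 [r2 [p [q [k [c [kK cS]]]]]]] := HA (- alpha); first by rewrite ltrNr.
  apply: (unimodal_of_profile l sigma P S hS i.+1 i.+1%:R r1 r2 p q alpha k c) => //.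
apply: filterS (filter_forall _ H) => alpha {}H.
have {H}/choice[u Hu] : forall i : 'I_N, exists u : R * R -> R, exists psi : R -> R,
    [/\ stationary_solution l sigma P S alpha (cst 0) u,
      exists2 y : R, - l <= y <= l & psi y != 0 &
      forall z, u z = psi z.2 * sin (i.+1%:R * z.1)] by [].
apply: (@le_trans _ _ N%:R%:E); first by rewrite lee_fin.
pose F (i : nat) := u (inord i) \_ (clOmega l).
(* Used in both orders, this yields injectivity of [F] below [N]. *)
have wave i j : (i < N)%N -> (j < N)%N -> F i = F j -> (j <= i)%N.
  move=> iN jN Fij.
  have [psi [_ [y yl psiy] ui]] := Hu (inord i).
  have [phi [_ _ uj]] := Hu (inord j).
  rewrite !inordK// in ui uj.
  apply: (sine_wave_inj l i.+1 j.+1 psi phi y) => // z zK.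
  rewrite -ui -uj; have := congr1 (fun f => f z) Fij.
  by rewrite /F !patchE mem_set.
rewrite /number_unimodal_solutions; apply: (counting_ge_inj _ _ F) => [i iN|i j iN jN Fij].
  have [psi [us [y yl psiy] ui]] := Hu (inord i).
  exists (u (inord i)) => //; split=> //.
  by exists i.+1, psi; split=> // [|z _]; [exists y|rewrite ui inordK].
by apply/eqP; rewrite eqn_leq (wave j i)// (wave i j).
Qed.
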